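(* Let $p:\mathbb{C}\to\mathbb{C}$ be a polynomial of degree $n$ with $d$ zeros located in the interior of the convex hull of the other zeros (inner zeros). For each inner zero $\zeta$ of $p$ which is not collinear with two other zeros of $p$, there is a sector defined by $\zeta$ and two adjacent rays from $\zeta$ through other zeros of $p$ whose interior does not contain a zero of the derivative $p'$.
   Context: $\mathbb{C}$ is identified with the Euclidean plane $\mathbb{R}^2$. The zeros of $p$ are allowed to be multiple (including the inner zeros); ''zeros'' in the geometric conditions means the distinct points of the zero set. A zero $\zeta$ of $p$ is called an inner zero if it lies in the (topological) interior of the convex hull of the set of zeros of $p$ different from $\zeta$. The condition that $\zeta$ is not collinear with two other zeros means that there are no two distinct zeros $z,z'$ of $p$, both different from $\zeta$, such that $\zeta,z,z'$ lie on a common line. For each zero $z\neq\zeta$ of $p$, the ray from $\zeta$ through $z$ is $\{\zeta+t(z-\zeta): t>0\}$. Under the non-collinearity condition these rays are pairwise distinct; two of them are adjacent if they are consecutive in the cyclic angular order around $\zeta$, i.e. one of the open angular regions with apex $\zeta$ that they bound contains none of the other rays. That region is the interior of the sector defined by $\zeta$ and the two adjacent rays. *)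

(* Defs.v *)
From HB Require Import structures.
From mathcomp Require Import all_boot all_order all_algebra complex.
From mathcomp Require Import all_classical all_reals all_analysis.

Set Implicit Arguments.
Unset Strict Implicit.
Unset Printing Implicit Defensive.

Import Order.TTheory GRing.Theory Num.Theory.

Local Open Scope classical_set_scope.
Local Open Scope ring_scope.
Local Open Scope complex_scope.

(* [Rcomplex R] is [R[i]] with its structure of real vector space, so the
   convex combinations have real coefficients. *)
Definition convex_hull (R : realType) (A : set R[i]) : set R[i] :=
  smallest (@convex_set R (Rcomplex R)) A.

Definition other_zeros (R : realType) (p : {poly R[i]}) (zeta : R[i]) :
    set R[i] :=
  [set z | root p z /\ z <> zeta].

(* The topology of [R[i]^o] is the one given by the complex modulus. *)
Definition inner_zero (R : realType) (p : {poly R[i]}) (zeta : R[i]) : Prop :=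
  root p zeta /\ (convex_hull (other_zeros p zeta) : set R[i]^o)° zeta.

Definition line (R : realType) (a v : R[i]) : set R[i] :=
  [set a + t%:C * v | t in [set: R]].

Definition collinear (R : realType) (x y z : R[i]) : Prop :=
  exists a v : R[i], v <> 0 /\ [set x; y; z] `<=` line a v.

Definition ray (R : realType) (zeta z : R[i]) : set R[i] :=
  [set zeta + t%:C * (z - zeta) | t in [set t : R | 0 < t]].

(* Rotating by the angle [phi] around [zeta], counterclockwise if [0 < phi],
   takes the direction of [u] to the direction of [v]. *)
Definition turn (R : realType) (zeta u v : R[i]) (phi : R) : Prop :=
  exists2 s : R, 0 < s &
    v - zeta = s%:C * (cos phi +i* sin phi) * (u - zeta).

(* The open angular region with apex [zeta] swept counterclockwise from the ray
   through [z] to the ray through [z'].  Two distinct rays bound two such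
   regions, obtained from one another by exchanging [z] and [z']. *)
Definition angular_region (R : realType) (zeta z z' : R[i]) : set R[i] :=
  [set w | exists phi theta : R,
    [/\ 0 < theta < phi, phi < 2 * pi, turn zeta z z' phi
      & turn zeta z w theta]].

(* The order of [z] and [z'] selects which of the two regions contains none of
   the other rays, i.e. which one is the interior of the sector. *)
Definition adjacent_rays (R : realType) (p : {poly R[i]})
    (zeta z z' : R[i]) : Prop :=
  [/\ other_zeros p zeta z, other_zeros p zeta z', ray zeta z <> ray zeta z'
    & forall y, other_zeros p zeta y ->
        ray zeta y <> ray zeta z -> ray zeta y <> ray zeta z' ->
        ~ (ray zeta y `<=` angular_region zeta z z')].

(* Main.v *)
Require Import Defs.
From mathcomp Require Import all_boot all_order all_algebra complex.
From mathcomp Require Import all_classical all_reals all_analysis.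
From mathcomp Require Import ring lra.

(** Write zeta, z_0, ..., z_(k-1) for the distinct zeros of p, with the z_i
sorted by their angle around zeta and z_k = z_0.  Over the common denominator
of the z_i and zeta, the logarithmic derivative p'/p has a numerator D of degree
k and leading coefficient n, the degree of p.  Suppose that every one of the k
sectors between z_i and z_(i+1) contained a critical point w_i.  The w_i are
distinct and are not zeros of p, so they are all the zeros of D and
D = n (X - w_0) ... (X - w_(k-1)).  At zeta only one term of D survives,
m (zeta - z_0) ... (zeta - z_(k-1)) with m the multiplicity of zeta, and
therefore the product of the quotients (w_i - zeta) / (z_i - zeta) is the
positive real number m / n ([critical_points_prod]).

On the other hand the argument t_i of the i-th quotient lies strictly between
0 and the opening of the i-th sector, and the openings add up to 2 pi.  So the
sum of the t_i lies strictly between 0 and 2 pi and the product cannot be a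
positive real ([cis_not_positive]).

An inner zero has at least two other zeros ([inner_zero_two_others]), so that
every sector is smaller than a full turn, and non-collinearity makes the angles
of the z_i pairwise distinct, so that there are as many sectors as z_i. *)

Import Order.TTheory GRing.Theory Num.Theory.
Local Open Scope classical_set_scope.
Local Open Scope ring_scope.
Local Open Scope complex_scope.

(** * The numerator of the logarithmic derivative *)

(** The sum of the [m z / ('X - z)] for [z] in [t], multiplied by the product of
the ['X - z].  The recursion makes the value at the head of [t] immediate: the
second summand vanishes there. *)
Fixpoint log_deriv_num {F : comNzRingType} (m : F -> nat) (t : seq F) :
    {poly F} :=
  if t is z :: t' then
    (m z)%:R *: \prod_(y <- t') ('X - y%:P) + ('X - z%:P) * log_deriv_num m t'
  else 0.

(** Factoring the [('X - z) ^+ (m z).-1] out of the derivative separates the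
critical points at multiple zeros from the others, which are roots of
[log_deriv_num]. *)
Lemma deriv_prod_XsubC_exp {F : comNzRingType} (m : F -> nat) (t : seq F)
    (m_gt0 : {in t, forall z, 0 < m z}%N) :
  (\prod_(z <- t) ('X - z%:P) ^+ m z)^`() =
  \prod_(z <- t) ('X - z%:P) ^+ (m z).-1 * log_deriv_num m t.
Proof.
elim: t m_gt0 => [_|z t IH m_gt0]; first by rewrite !big_nil /= derivC mulr0.
have {}IH := IH (fun y yt => m_gt0 y (@mem_behead _ (z :: t) y yt)).
have prodS : \prod_(y <- t) ('X - y%:P) ^+ m y =
    \prod_(y <- t) ('X - y%:P) ^+ (m y).-1 * \prod_(y <- t) ('X - y%:P).
  rewrite -big_split big_seq_cond [RHS]big_seq_cond /=; apply: eq_bigr => y.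
  by rewrite andbT => yt; rewrite -exprSr prednK // m_gt0 ?inE ?yt ?orbT.
rewrite !big_cons derivM IH deriv_exp derivXsubC mul1r prodS /=.
case: (m z) (m_gt0 z (mem_head _ _)) => // k _.
by rewrite exprS -mulr_natl scaler_nat -mulr_natl; ring.
Qed.

Lemma size_log_deriv_num {F : comNzRingType} (m : F -> nat) (t : seq F) :
  (size (log_deriv_num m t) <= size t)%N.
Proof.
elim: t => [|z t IH] /=; first by rewrite size_poly0.
apply: (leq_trans (size_polyD _ _)); rewrite geq_max; apply/andP; split.
  by apply: (leq_trans (size_scale_leq _ _)); rewrite size_prod_XsubC.
apply: (leq_trans (size_polyMleq _ _)).
by rewrite size_XsubC.
Qed.

(** Each summand is [m z] times a monic polynomial of degree [(size t).-1], so
that the coefficient of this degree is the total multiplicity. *)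
Lemma coef_log_deriv_num {F : comNzRingType} (m : F -> nat) (t : seq F) :
  (log_deriv_num m t)`_(size t).-1 = (\sum_(z <- t) m z)%:R.
Proof.
elim: t => [|z t IH] /=; first by rewrite big_nil coef0.
rewrite big_cons natrD -IH coefD coefZ; congr (_ + _).
  have /monicP := monic_prod_XsubC t xpredT id.
  by rewrite lead_coefE size_prod_XsubC /= => ->; rewrite mulr1.
rewrite mulrBl coefB coefXM coefCM [X in z * X]nth_default ?size_log_deriv_num //.
case: t {IH} => [|y t] /=.
  by rewrite coef0 mulr0 subr0.
by rewrite mulr0 subr0.
Qed.

(** If [p] has as many critical points off its zeros as it has zeros besides
[zeta], then these account for all roots of the numerator [D] of the logarithmic
derivative, whose degree is [size s].  Both sides are values at [zeta] of [D]:
on the left from its factorization, on the right from its definition.  Here [n]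
is the degree of [p] and [m] the multiplicity of [zeta]. *)
Lemma critical_points_prod {F : numClosedFieldType} (p : {poly F}) (zeta : F)
    (s W : seq F) :
    p != 0 -> uniq (zeta :: s) -> (forall z, (z \in zeta :: s) = root p z) ->
    uniq W -> size W = size s ->
    {in W, forall w, root p^`() w /\ ~~ root p w} ->
  exists m n : nat, [/\ (0 < m)%N, (0 < n)%N &
    n%:R * \prod_(w <- W) (zeta - w) = m%:R * \prod_(z <- s) (zeta - z)].
Proof.
move=> p0 us rootE uW sW hW.
have [r pE] := closed_field_poly_normal p.
have lc0 : lead_coef p != 0 by rewrite lead_coef_eq0.
have memr z : (z \in r) = root p z.
  by rewrite pE rootZ // root_prod_XsubC.
pose m z := count_mem z r.
set t := zeta :: s in us rootE.
have m_gt0 : {in t, forall z, 0 < m z}%N.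
  by move=> z; rewrite rootE -memr /m -has_count has_pred1.
have pE' : p = lead_coef p *: \prod_(z <- t) ('X - z%:P) ^+ m z.
  rewrite {1}pE -prodr_undup_exp_count; congr (_ *: _).
  apply: perm_big; apply: uniq_perm => //; first exact: undup_uniq.
  by move=> z; rewrite mem_undup memr rootE.
pose D := log_deriv_num m t; pose n := (\sum_(z <- t) m z)%N.
have n_gt0 : (0 < n)%N.
  by rewrite /n /t big_cons (leq_trans (m_gt0 _ (mem_head _ _))) ?leq_addr.
have DE : D = n%:R *: \prod_(w <- W) ('X - w%:P).
  (* the top coefficient is n, which is nonzero in characteristic 0 *)
  have sD : size D = (size W).+1.
    apply/eqP; rewrite eqn_leq sW size_log_deriv_num /= ltnNge.
    apply/negP => /(nth_default 0) D0.
    have := coef_log_deriv_num m t; rewrite /= -/D D0 => /esym/eqP.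
    by rewrite -/n pnatr_eq0 (gtn_eqF n_gt0).
  have <- : lead_coef D = n%:R.
    by rewrite lead_coefE sD sW /= -(coef_log_deriv_num m t).
  apply: all_roots_prod_XsubC => //; last by rewrite uniq_rootsE.
  apply/allP => w /hW [+ nrw].
  rewrite {1}pE' derivZ rootZ // deriv_prod_XsubC_exp // rootM => /orP[|//].
  move/rootP; rewrite horner_prod => /eqP; rewrite prodf_seq_eq0 => /hasP[z zt].
  rewrite /= horner_exp hornerXsubC expf_eq0 subr_eq0 => /andP[_ /eqP wz].
  by move: nrw; rewrite wz -rootE zt.
exists (m zeta), n; split => //; first exact/m_gt0/mem_head.
have : D.[zeta] = (m zeta)%:R * \prod_(z <- s) (zeta - z).
  rewrite /D /= hornerD hornerM hornerXsubC subrr mul0r addr0 hornerZ.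
  by rewrite horner_prod; under eq_bigr do rewrite hornerXsubC.
rewrite DE hornerZ horner_prod => <-.
by under [in RHS]eq_bigr do rewrite hornerXsubC.
Qed.

(** * Arguments of complex numbers *)

Section Directions.
Context {R : realType}.
Implicit Types (a b t : R) (u v z w zeta : R[i]).

Definition cis t : R[i] := cos t +i* sin t.

Lemma cisD a b : cis (a + b) = cis a * cis b.
Proof. by rewrite /cis cosD sinD; simpc; rewrite [cos a * sin b + _]addrC. Qed.

Lemma cis2pi : cis (2 * pi) = 1.
Proof. by rewrite /cis mulr_natl cos2pi sin2pi. Qed.

Lemma prod_cis (k : nat) (r t : nat -> R) :
  \prod_(0 <= i < k) ((r i)%:C * cis (t i)) =
  (\prod_(0 <= i < k) r i)%:C * cis (\sum_(0 <= i < k) t i).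
Proof.
elim: k => [|k IH]; first by rewrite !big_nil /cis cos0 sin0 mul1r.
by rewrite !big_nat_recr //= IH cisD rmorphM /=; ring.
Qed.

(** By the double angle formula, [1 - cos t] is twice the square of
[sin (t / 2)]. *)
Lemma cos_lt1 {t} : 0 < t < 2 * pi -> cos t < 1.
Proof.
move=> /andP[t0 t2pi].
have -> : t = (t / 2) *+ 2 by rewrite -mulr_natr divfK.
have s0 : 0 < sin (t / 2).
  by apply: sin_gt0_pi; rewrite divr_gt0 //= ltr_pdivrMr // mulrC.
have := cos2Dsin2 (t / 2); have := exprn_gt0 2 s0.
by rewrite cos_mulr2n; lra.
Qed.

Lemma cis_not_positive {c t x : R} :
  0 < t < 2 * pi -> 0 < c -> 0 < x -> x%:C * cis t <> c%:C.
Proof.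
move=> t2pi c0 x0; rewrite /cis; simpc => -[xc /eqP].
rewrite mulf_eq0 (gt_eqF x0) /= => /eqP s0.
have := cos2Dsin2 t; rewrite s0 expr0n addr0 => /eqP.
rewrite sqrf_eq1 => /orP[] /eqP ct; first by have := cos_lt1 t2pi; rewrite ct ltxx.
by move: c0; rewrite -xc ct; lra.
Qed.

(** [t] is one of the arguments of [u]; it is determined up to multiples of
[2 * pi].  No such [t] exists for [u = 0]. *)
Definition direction u t := exists2 r : R, 0 < r & u = r%:C * cis t.

Lemma cis_neq0 t : cis t != 0.
Proof.
apply/eqP => -[c0 s0]; have := cos2Dsin2 t.
by rewrite c0 s0 expr0n addr0 => /esym/eqP; rewrite oner_eq0.
Qed.

Lemma realC_gt0_neq0 {r : R} : 0 < r -> r%:C != 0 :> R[i].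
Proof. by move=> r0; rewrite fmorph_eq0 gt_eqF. Qed.

Lemma direction_inj {u a b} :
  direction u a -> direction u b -> a < b -> b < a + 2 * pi -> False.
Proof.
move=> [r r0 ->] [s s0 e] ab ba.
have ba2 : 0 < b - a < 2 * pi by rewrite subr_gt0 ab ltrBlDl.
apply: (cis_not_positive ba2 r0 s0).
apply: (mulIf (cis_neq0 a)); rewrite e -mulrA -cisD; congr (_ * cis _); lra.
Qed.

Lemma direction_shift {u t} : direction u t -> direction u (t + 2 * pi).
Proof. by move=> [r r0 ->]; exists r => //; rewrite cisD cis2pi mulr1. Qed.

(** In the upper half plane [acos] of the normalized real part is an argument;
in the lower one its opposite is, and is shifted by [2 * pi]. *)
Lemma direction_exists {u} :
  u != 0 -> exists t, 0 <= t < 2 * pi /\ direction u t.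
Proof.
case: u => x y u0.
have n0 : 0 < x ^+ 2 + y ^+ 2.
  rewrite lt0r addr_ge0 ?sqr_ge0 // andbT paddr_eq0 ?sqr_ge0 // !sqrf_eq0.
  by move: u0; rewrite eq_complex.
pose r := Num.sqrt (x ^+ 2 + y ^+ 2).
have r0 : 0 < r by rewrite sqrtr_gt0.
have r2 : r ^+ 2 = x ^+ 2 + y ^+ 2 by rewrite sqr_sqrtr // ltW.
pose c := x / r; pose d := y / r.
have xE : x = r * c by rewrite /c mulrC divfK // gt_eqF.
have yE : y = r * d by rewrite /d mulrC divfK // gt_eqF.
have cd : d ^+ 2 = 1 - c ^+ 2.
  rewrite /c /d !expr_div_n r2; field; exact: lt0r_neq0.
have c1 : -1 <= c <= 1 by have := sqr_ge0 d; rewrite cd; nra.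
have ac : cos (acos c) = c by apply: acosK; rewrite in_itv.
have pi0 := pi_gt0 R.
have [d0|d0] := leP 0 d.
  exists (acos c); split.
    by have := acos_ge0 c1; have := acos_lepi c1; lra.
  exists r => //; rewrite /cis sin_acos // -cd sqrtr_sqr (ger0_norm d0) ac.
  by simpc; rewrite -xE -yE.
have ca : 0 < acos c.
  apply: acos_gt0; case/andP: c1 => -> c1 /=; rewrite lt_neqAle c1 andbT.
  by apply/eqP => cE; move: cd; rewrite cE expr1n subrr; nra.
exists (- acos c + 2 * pi); split; first by have := acos_lepi c1; lra.
apply: direction_shift; exists r => //.
rewrite /cis cosN sinN sin_acos // -cd sqrtr_sqr (ltr0_norm d0) ac opprK.
by simpc; rewrite -xE -yE.
Qed.

Lemma turn_direction {zeta z w a t} :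
  direction (z - zeta) a -> turn zeta z w t -> direction (w - zeta) (a + t).
Proof.
move=> [r r0 zE] [s s0 wE]; exists (s * r); first exact: mulr_gt0.
by rewrite wE zE cisD rmorphM /= -/(cis t); ring.
Qed.

Lemma direction_turn {zeta z w a b} :
  direction (z - zeta) a -> direction (w - zeta) b -> turn zeta z w (b - a).
Proof.
move=> [r r0 zE] [s s0 wE]; exists (s / r); first exact: divr_gt0.
rewrite wE zE -/(cis (b - a)) mulrACA -rmorphM /= divfK ?gt_eqF //.
by rewrite -cisD subrK.
Qed.

Lemma ray_direction {zeta z w a} :
  direction (z - zeta) a -> ray zeta z w -> direction (w - zeta) a.
Proof.
move=> [r r0 zE] [t t0 <-]; exists (t * r); first exact: mulr_gt0.
by rewrite zE rmorphM /=; ring.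
Qed.

Lemma ray_self zeta z : ray zeta z z.
Proof. by exists 1 => /=; rewrite ?ltr01 // mul1r addrC subrK. Qed.

Lemma collinear_direction {zeta z w a} :
  direction (z - zeta) a -> direction (w - zeta) a -> collinear zeta z w.
Proof.
move=> [r _ zE] [s _ wE]; exists zeta, (cis a); split; first exact/eqP/cis_neq0.
move=> x [[->|->]|->]; first by exists 0 => //=; rewrite mul0r addr0.
  by exists r => //=; rewrite -zE addrC subrK.
by exists s => //=; rewrite -wE addrC subrK.
Qed.

(** A set with at most one point is convex, so it would be its own hull, and
the hull contains [zeta], which is not one of the other zeros. *)
Lemma inner_zero_two_others {p : {poly R[i]}} {zeta} :
  inner_zero p zeta ->
  exists z z', [/\ other_zeros p zeta z, other_zeros p zeta z' & z <> z'].
Proof.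
move=> [_ hull_zeta]; apply: contrapT => one.
have hull_sub : convex_hull (other_zeros p zeta) `<=` other_zeros p zeta.
  apply: smallest_sub => // x y l /set_mem xp /set_mem yp.
  have [xy|xy] := eqVneq x y; first by rewrite xy convmm; exact/mem_set.
  by exfalso; apply: one; exists x, y; split=> //; exact/eqP.
by have /(hull_sub zeta)[] := interior_subset hull_zeta.
Qed.

End Directions.

(** * The sectors around a point *)

Section CyclicOrder.
Set Implicit Arguments.
Unset Strict Implicit.
Context {R : realType}.
Variables (zeta : R[i]) (s : seq R[i]) (ang : R[i] -> R).
Hypothesis s_gt1 : (1 < size s)%N.
Hypothesis ang_bound : {in s, forall z, 0 <= ang z < 2 * pi}.
Hypothesis angP : {in s, forall z, direction (z - zeta) (ang z)}.
Hypothesis ang_sorted : sorted <%R [seq ang z | z <- s].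

(** The default value of [nth] closes the cycle: [cyc (size s)] is [cyc 0]. *)
Definition cyc (i : nat) : R[i] := nth (head zeta s) s i.

(** The first point gets, when it comes back at index [size s], an angle one full
turn larger, so that angles increase along the whole cycle and the opening of
the [i]-th sector is always [cyc_ang i.+1 - cyc_ang i]. *)
Definition cyc_ang (i : nat) : R :=
  if (i < size s)%N then ang (cyc i) else ang (cyc 0) + 2 * pi.

Lemma cyc_mem i : cyc i \in s.
Proof.
have h : head zeta s \in s by case: s s_gt1 => // x t _; exact: mem_head.
by rewrite /cyc; case: (ltnP i (size s)) => ik; [rewrite mem_nth|rewrite nth_default].
Qed.

Lemma cyc_angP i : direction (cyc i - zeta) (cyc_ang i).
Proof.
rewrite /cyc_ang; case: ltnP => ik; first exact/angP/cyc_mem.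
suff -> : cyc i = cyc 0 by apply/direction_shift/angP/cyc_mem.
by rewrite /cyc nth_default //; case: s s_gt1.
Qed.

Lemma cyc_ang_lt i j : (i < j <= size s)%N -> cyc_ang i < cyc_ang j.
Proof.
move=> /andP[ij jk]; rewrite /cyc_ang (leq_trans ij jk).
have [js|_] := ltnP j (size s); last first.
  have /andP[_ +] := ang_bound (cyc_mem i).
  by have /andP[+ _] := ang_bound (cyc_mem 0); lra.
have := sorted_ltn_nth lt_trans 0 ang_sorted i j.
rewrite !inE size_map js (ltn_trans ij js) !(nth_map (head zeta s)) //; first exact.
exact: ltn_trans js.
Qed.

Lemma cyc_ang_le i j : (i <= j <= size s)%N -> cyc_ang i <= cyc_ang j.
Proof.
move=> /andP[]; rewrite leq_eqVlt => /predU1P[->//|ij] jk.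
by apply/ltW/cyc_ang_lt; rewrite ij.
Qed.

Lemma cyc_ang_last : cyc_ang (size s) = cyc_ang 0 + 2 * pi.
Proof. by rewrite /cyc_ang ltnn (ltn_trans _ s_gt1). Qed.

(** This is where at least two points are needed: around a single one the gap
would be the full turn. *)
Lemma cyc_gap i : (i < size s)%N ->
  0 < cyc_ang i.+1 - cyc_ang i < 2 * pi.
Proof.
move=> ik; have lt1 := @cyc_ang_lt i i.+1; rewrite ltnSn ik /= in lt1.
rewrite subr_gt0 lt1 //= ltrBlDl.
have [->|i0] := posnP i.
  by rewrite -cyc_ang_last; apply: cyc_ang_lt; rewrite s_gt1 leqnn.
have := @cyc_ang_lt 0 i; rewrite i0 (ltnW ik) => /(_ isT).
have := @cyc_ang_le i.+1 (size s); rewrite ik leqnn cyc_ang_last => /(_ isT).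
by lra.
Qed.

(** The angles of the points up to [i] are smaller than [t], those of the later
points larger, all by less than a full turn. *)
Lemma no_point_in_gap i y t : (i < size s)%N -> y \in s ->
  cyc_ang i < t < cyc_ang i.+1 -> ~ direction (y - zeta) t.
Proof.
move=> ik /(nthP (head zeta s))[j jk <-] /andP[it ti] yt.
have yj : direction (nth (head zeta s) s j - zeta) (cyc_ang j) by exact: cyc_angP.
have first_le : cyc_ang 0 <= cyc_ang i by apply: cyc_ang_le; rewrite (ltnW ik).
have [ij|ji] := ltnP i j.
  have lej : cyc_ang i.+1 <= cyc_ang j by apply: cyc_ang_le; rewrite ij (ltnW jk).
  have ltk : cyc_ang j < cyc_ang (size s) by apply: cyc_ang_lt; rewrite jk leqnn.
  by apply: (direction_inj yt yj); move: ltk; rewrite ?cyc_ang_last; lra.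
have lei : cyc_ang j <= cyc_ang i by apply: cyc_ang_le; rewrite ji (ltnW ik).
have lek : cyc_ang i.+1 <= cyc_ang (size s) by apply: cyc_ang_le; rewrite ik leqnn.
have le0 : cyc_ang 0 <= cyc_ang j by apply: cyc_ang_le; rewrite (ltnW jk).
by apply: (direction_inj yj yt); move: lek; rewrite ?cyc_ang_last; lra.
Qed.

(** The angle [phi] of the sector in [angular_region] is only known through a
rotation; since both lie strictly between 0 and a full turn, it must be the
difference of the angles. *)
Lemma sector_direction i w : (i < size s)%N ->
  angular_region zeta (cyc i) (cyc i.+1) w ->
  exists2 t, 0 < t < cyc_ang i.+1 - cyc_ang i & turn zeta (cyc i) w t.
Proof.
move=> ik [phi [t [/andP[t0 tphi] phi2 /(turn_direction (cyc_angP i)) dphi wt]]].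
exists t => //; rewrite t0 /=.
have /andP[g0 g2] := cyc_gap ik.
suff <- : phi = cyc_ang i.+1 - cyc_ang i by [].
have d1 := cyc_angP i.+1.
have [lt|gt|] := ltgtP (cyc_ang i + phi) (cyc_ang i.+1); last by lra.
  by exfalso; apply: (direction_inj dphi d1 lt); lra.
by exfalso; apply: (direction_inj d1 dphi gt); lra.
Qed.

Lemma cyc_adjacent (p : {poly R[i]}) i :
  (forall z, z \in s <-> other_zeros p zeta z) -> (i < size s)%N ->
  adjacent_rays p zeta (cyc i) (cyc i.+1).
Proof.
move=> sP ik; split; first exact/sP/cyc_mem.
- exact/sP/cyc_mem.
- have /andP[g0 g2] := cyc_gap ik; move=> e.
  have := ray_self zeta (cyc i.+1); rewrite -e.
  move=> /(ray_direction (cyc_angP i)) d.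
  by apply: (direction_inj d (cyc_angP i.+1)); lra.
move=> y /sP ys _ _ /(_ y (ray_self zeta y)) /(sector_direction ik)[t tg].
move=> /(turn_direction (cyc_angP i)); apply: (no_point_in_gap ik ys); lra.
Qed.

(** Critical points chosen in all the sectors would be distinct and outside the
zeros, hence subject to [critical_points_prod]: the product of the
[r i * cis (t i)], the quotients of the [w i - zeta] by the [cyc i - zeta], would
be positive, although the [t i] add up to less than a full turn. *)
Lemma sector_without_critical_point (p : {poly R[i]}) :
  p != 0 -> root p zeta -> uniq s ->
  (forall z, z \in s <-> other_zeros p zeta z) ->
  exists2 i, (i < size s)%N &
    forall w, angular_region zeta (cyc i) (cyc i.+1) w -> ~ root p^`() w.
Proof.
move=> p0 pzeta us sP; apply: contrapT => noi.
have /choice[f fP] (i : nat) : exists x : R[i] * R, (i < size s)%N ->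
    [/\ root p^`() x.1, 0 < x.2 < cyc_ang i.+1 - cyc_ang i &
        turn zeta (cyc i) x.1 x.2].
  have [ik|] := ltnP i (size s); last by exists (0, 0).
  have [w wP] : exists w, angular_region zeta (cyc i) (cyc i.+1) w /\ root p^`() w.
    apply: contrapT => now; apply: noi; exists i => // w wi wr.
    by apply: now; exists w.
  case: wP => /(sector_direction ik)[t tg wt] wr.
  by exists (w, t).
pose w i := (f i).1; pose t i := (f i).2.
have wr i : (i < size s)%N -> root p^`() (w i) by move=> /fP[].
have tg i : (i < size s)%N -> 0 < t i < cyc_ang i.+1 - cyc_ang i by move=> /fP[].
have /choice[r rP] (i : nat) : exists r : R, (i < size s)%N ->
    0 < r /\ w i - zeta = r%:C * cis (t i) * (cyc i - zeta).
  have [ik|] := ltnP i (size s); last by exists 0.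
  by have [_ _ [r r0 wE]] := fP i ik; exists r.
have wd i : (i < size s)%N -> direction (w i - zeta) (cyc_ang i + t i).
  by move=> /fP[_ _]; exact: turn_direction (cyc_angP i).
have wang i : (i < size s)%N -> cyc_ang i < cyc_ang i + t i < cyc_ang i.+1.
  by move=> /tg; lra.
have w_neq i j : (i < j < size s)%N -> w i <> w j.
  move=> /andP[ij jk] wij; have ik := ltn_trans ij jk.
  have di := wd i ik; have dj := wd j jk; rewrite -wij in dj.
  have [wi wj] := (wang i ik, wang j jk).
  have a1 : cyc_ang i.+1 <= cyc_ang j by apply: cyc_ang_le; rewrite ij (ltnW jk).
  have a2 : cyc_ang j.+1 <= cyc_ang (size s) by apply: cyc_ang_le; rewrite jk leqnn.
  have a3 : cyc_ang 0 <= cyc_ang i by apply: cyc_ang_le; rewrite (ltnW ik).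
  by apply: (direction_inj di dj); move: a2; rewrite ?cyc_ang_last; lra.
pose W := [seq w i | i <- iota 0 (size s)].
have uW : uniq W.
  rewrite map_inj_in_uniq ?iota_uniq // => i j.
  rewrite !mem_iota !add0n /= => ik jk wij.
  by have [ij|ji|//] := ltngtP i j; [case: (w_neq i j)|case: (w_neq j i)];
    rewrite ?ij ?ji ?wij.
have memt z : (z \in zeta :: s) = root p z.
  rewrite inE; apply/idP/idP => [/predU1P[->//|/sP[]//]|zr].
  by have [//|/eqP zz] := eqVneq z zeta; apply/sP.
have ut : uniq (zeta :: s) by rewrite /= us andbT; apply/negP => /sP[].
have sW : size W = size s by rewrite size_map size_iota.
have hW : {in W, forall x, root p^`() x /\ ~~ root p x}.
  move=> x /mapP[k]; rewrite mem_iota /= add0n => kk ->; split; first exact: wr.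
  rewrite -memt inE negb_or; apply/andP; split; apply/negP.
    have [r' r0 wE] := wd k kk; rewrite -subr_eq0 wE mulf_eq0.
    by rewrite (negbTE (realC_gt0_neq0 r0)) (negbTE (cis_neq0 _)).
  by move=> ws; apply: (no_point_in_gap kk ws (wang k kk)); exact: wd.
have [m [n [m0 n0]]] := critical_points_prod p zeta s W p0 ut memt uW sW hW.
have -> : \prod_(x <- W) (zeta - x) =
    \prod_(0 <= i < size s) ((r i)%:C * cis (t i)) * \prod_(z <- s) (zeta - z).
  rewrite big_map (big_nth (head zeta s)) -big_split /= /index_iota subn0.
  rewrite !big_seq; apply: eq_bigr => i; rewrite mem_iota /= add0n => ik.
  by have [_ wE] := rP i ik; rewrite -[zeta - w i]opprB wE -mulrN opprB.
rewrite prod_cis mulrA.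
have zs0 : \prod_(z <- s) (zeta - z) != 0.
  rewrite prodf_seq_neq0; apply/allP => z /sP[_ /eqP zz] /=.
  by rewrite subr_eq0 eq_sym.
move=> /(mulIf zs0).
have -> : n%:R = (n%:R : R)%:C :> R[i] by rewrite rmorph_nat.
have -> : m%:R = (m%:R : R)%:C :> R[i] by rewrite rmorph_nat.
rewrite mulrA -rmorphM /=.
have s0 : (0 < size s)%N := ltnW s_gt1.
apply: cis_not_positive; last 2 first.
- by rewrite ltr0n.
- rewrite mulr_gt0 ?ltr0n // big_mkord prodr_gt0 // => i _.
  by have [] := rP i (ltn_ord i).
have sumg : \sum_(0 <= i < size s) (cyc_ang i.+1 - cyc_ang i) = 2 * pi.
  by rewrite telescope_sumr // cyc_ang_last addrAC subrr add0r.
rewrite -sumg; apply/andP; split.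
  rewrite -[ltLHS](_ : \sum_(0 <= i < size s) (0 : R) = 0); last by rewrite big1.
  by apply: (ltr_sum_nat s0) => i /andP[_ /tg /andP[]].
by apply: (ltr_sum_nat s0) => i /andP[_ /tg /andP[]].
Qed.

End CyclicOrder.

Theorem theorem3p1 (R : realType) (p : {poly R[i]}) (n d : nat)
    (degree_p : size p = n.+1)
    (inner_p : ([set z | inner_zero p z] #= `I_d)%card)
    (zeta : R[i]) (inner_zeta : inner_zero p zeta)
    (not_collinear : forall z z' : R[i],
       other_zeros p zeta z -> other_zeros p zeta z' -> z <> z' ->
       ~ collinear zeta z z') :
  exists z z' : R[i], adjacent_rays p zeta z z' /\
    forall w : R[i], angular_region zeta z z' w -> ~ root p^`() w.
Proof.
have p0 : p != 0 by rewrite -size_poly_eq0 degree_p.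
have pzeta : root p zeta by case: inner_zeta.
have [ang angP] : {ang : R[i] -> R & forall z, z != zeta ->
    0 <= ang z < 2 * pi /\ direction (z - zeta) (ang z)}.
  apply: (@choice _ _ (fun z t => z != zeta ->
    0 <= t < 2 * pi /\ direction (z - zeta) t)) => z.
  have [->|zz] := eqVneq z zeta; first by exists 0.
  have [t tP] : exists t, 0 <= t < 2 * pi /\ direction (z - zeta) t.
    by apply: direction_exists; rewrite subr_eq0.
  by exists t.
have [rs pE] := closed_field_poly_normal p.
pose s0 := [seq z <- undup rs | z != zeta].
pose s := sort (fun x y => ang x <= ang y) s0.
have sP z : z \in s <-> other_zeros p zeta z.
  rewrite mem_sort mem_filter mem_undup -root_prod_XsubC.
  rewrite -(rootZ _ _ (_ : lead_coef p != 0)) ?lead_coef_eq0 // -pE.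
  by split=> [/andP[/eqP ? ?]|[? /eqP ?]]; [split|apply/andP].
have angPs : {in s, forall z, 0 <= ang z < 2 * pi /\
    direction (z - zeta) (ang z)}.
  by move=> z /sP[_ /eqP /angP].
have us : uniq s by rewrite sort_uniq filter_uniq // undup_uniq.
have ang_inj : {in s &, injective ang}.
  move=> z z' zs z's e; apply/eqP/negP => /negP/eqP zz'.
  have [_ d1] := angPs z zs; have [_ d2] := angPs z' z's.
  apply: (not_collinear z z' _ _ zz'); [exact/sP|exact/sP|].
  by apply: (collinear_direction d1); rewrite e.
have ang_sorted : sorted <%R [seq ang z | z <- s].
  rewrite lt_sorted_uniq_le map_inj_in_uniq // us /= sorted_map.
  by apply: sort_sorted => x y; exact: le_total.
have s_gt1 : (1 < size s)%N.
  have [z [z' [/sP zs /sP z's zz']]] := inner_zero_two_others inner_zeta.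
  rewrite ltnNge; apply/negP; case: s zs z's {sP angPs us ang_inj ang_sorted} => [//|x [|//]].
  by rewrite !inE => /eqP zx /eqP z'x; case: zz'; rewrite zx z'x.
have bounds : {in s, forall z, 0 <= ang z < 2 * pi} by move=> z /angPs[].
have dirs : {in s, forall z, direction (z - zeta) (ang z)} by move=> z /angPs[].
have [i ik iP] := sector_without_critical_point
  s_gt1 bounds dirs ang_sorted p0 pzeta us sP.
exists (cyc zeta s i), (cyc zeta s i.+1); split => //.
exact: (cyc_adjacent s_gt1 bounds dirs ang_sorted).
Qed.
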